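(* Let $X$ be an Archimedean vector lattice and let $\tau$ be a metrizable locally solid topology on $X$. Let $(\widehat X,\widehat\tau)$ be the topological completion of $(X,\tau)$. The following statements are equivalent: (i) There is an at most countable set $A$ in $X$ such that $\overline{I(A)}^{\tau}=X$; (ii) $u\tau$ is metrizable; (iii) $u\widehat\tau$ is metrizable; (iv) The topological completion $\widehat X$ contains a quasi-interior point (of $(\widehat X,\widehat\tau)$).
   Context: All vector lattices are assumed Archimedean. A linear topology on a vector lattice is locally solid if it has a base at zero consisting of solid sets ($S$ is solid if $|x|\le|y|$ and $y\in S$ imply $x\in S$). A topology is metrizable if it is the metric topology of some metric. If $\tau$ is locally solid on $X$ with a base at zero $\{U_i\}$ of solid sets, the unbounded $\tau$-topology $u\tau$ is the locally solid topology on $X$ with base at zero consisting of the sets $U_{i,u}=\{x\in X:\ |x|\wedge u\in U_i\}$, over all $i$ and all $u\in X_+$. $I(A)$ denotes the order ideal generated by $A$, $I_e:=I(\{e\})$, and $\overline{\,\cdot\,}^{\tau}$ denotes $\tau$-closure. A positive vector $e$ of a locally solid vector lattice $(Y,\sigma)$ is a quasi-interior point of $(Y,\sigma)$ if $I_e$ is $\sigma$-dense in $Y$. For Hausdorff locally solid $(X,\tau)$, $(\widehat X,\widehat\tau)$ denotes the topological (vector space) completion, ordered by the cone that is the $\widehat\tau$-closure of $X_+$ in $\widehat X$; with it $(\widehat X,\widehat\tau)$ is a Hausdorff locally solid vector lattice containing $X$ as a $\widehat\tau$-dense vector sublattice. *)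

(* Defs.v *)
From HB Require Import structures.
From mathcomp Require Import all_boot all_order all_algebra.
From mathcomp Require Import all_classical all_reals all_analysis.

Set Implicit Arguments.
Unset Strict Implicit.
Unset Printing Implicit Defensive.

Import Order.TTheory GRing.Theory Num.Theory.
Import numFieldNormedType.Exports.

Local Open Scope classical_set_scope.
Local Open Scope ring_scope.

(* The lattice operations are given here and not by [Order.Lattice]: Hierarchy
   Builder refuses a join of [Order.Lattice] and [GRing.Lmodule] declared
   downstream of [Num.RealDomain]. *)
HB.mixin Record POrderedLmodule_isVectorLattice (R : realType) E
    & GRing.Lmodule R E & Num.POrderedZmodule E := {
  vmeet : E -> E -> E ;
  vjoin : E -> E -> E ;
  vlexI : forall x y z : E, (x <= vmeet y z) = (x <= y) && (x <= z) ;
  vleUx : forall x y z : E, (vjoin x y <= z) = (x <= z) && (y <= z) ;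
  vl_leD2r : forall z x y : E, x <= y -> x + z <= y + z ;
  vl_scale_ge0 : forall (a : R) (x : E), 0 <= a -> 0 <= x -> 0 <= a *: x
}.

#[short(type="vectorLatticeType")]
HB.structure Definition VectorLattice (R : realType) :=
  {E of GRing.Lmodule R E & Num.POrderedZmodule E
      & POrderedLmodule_isVectorLattice R E}.

Section VectorLattice.
Variables (R : realType) (X : vectorLatticeType R).
Implicit Types (x y : X) (A S : set X).

Definition vabs x : X := vjoin x (- x).

Definition archimedean :=
  forall x y, 0 <= x -> 0 <= y -> (forall n : nat, x *+ n <= y) -> x = 0.

Definition solid S := forall x y, vabs x <= vabs y -> S y -> S x.

Definition order_ideal S :=
  [/\ S 0, forall x y, S x -> S y -> S (x + y),
      forall (a : R) x, S x -> S (a *: x) & solid S].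

Definition ideal_gen A : set X := smallest order_ideal A.

End VectorLattice.

(* The topology is an arbitrary linear one: [TopologicalLmodule], unlike [Tvs],
   asks neither for local convexity nor for separation. *)
HB.mixin Record VectorLattice_isLocallySolid (R : realType) E
    & VectorLattice R E & TopologicalLmodule R E := {
  solid_base0 : forall U : set E, nbhs 0 U ->
    exists V : set E, [/\ nbhs 0 V, solid V & V `<=` U]
}.

#[short(type="locallySolidType")]
HB.structure Definition LocallySolid (R : realType) :=
  {E of VectorLattice R E & TopologicalLmodule R E
      & VectorLattice_isLocallySolid R E}.

Section VectorLatticeTheory.
Variables (R : realType) (X : vectorLatticeType R).
Implicit Types x y z u a b : X.

Lemma vleIl x y : vmeet x y <= x.
Proof. by have := lexx (vmeet x y); rewrite vlexI => /andP[]. Qed.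

Lemma vleIr x y : vmeet x y <= y.
Proof. by have := lexx (vmeet x y); rewrite vlexI => /andP[]. Qed.

Lemma vleUl x y : x <= vjoin x y.
Proof. by have := lexx (vjoin x y); rewrite vleUx => /andP[]. Qed.

Lemma vleUr x y : y <= vjoin x y.
Proof. by have := lexx (vjoin x y); rewrite vleUx => /andP[]. Qed.

Lemma vleI2 x y z t : x <= z -> y <= t -> vmeet x y <= vmeet z t.
Proof.
move=> xz yt; rewrite vlexI (le_trans (vleIl _ _) xz).
exact: le_trans (vleIr _ _) yt.
Qed.

Lemma vmeet0 x : 0 <= x -> vmeet 0 x = 0.
Proof. by move=> x0; apply/le_anti; rewrite vleIl vlexI lexx x0. Qed.

Lemma vl_leD2E z x y : (x + z <= y + z) = (x <= y).
Proof.
apply/idP/idP => [h|]; last exact: vl_leD2r.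
by have := vl_leD2r (- z) _ _ h; rewrite !addrK.
Qed.

Lemma vl_leBlDr x y z : (x - y <= z) = (x <= z + y).
Proof. by rewrite -(vl_leD2E y (x - y) z) subrK. Qed.

Lemma vl_leD x y z t : x <= y -> z <= t -> x + z <= y + t.
Proof.
move=> xy zt; apply: (@le_trans _ _ (y + z)); first exact: vl_leD2r.
by rewrite ![y + _]addrC; exact: vl_leD2r.
Qed.

Lemma le_vabs x : x <= vabs x. Proof. exact: vleUl. Qed.

Lemma lenr_vabs x : - x <= vabs x. Proof. exact: vleUr. Qed.

Lemma vabs_ge0 x : 0 <= vabs x.
Proof.
have h : 0 <= vabs x + vabs x.
  by rewrite -(subrr x); apply: vl_leD; [exact: le_vabs|exact: lenr_vabs].
have : 0 <= (2^-1 : R) *: (vabs x + vabs x).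
  by apply: vl_scale_ge0 => //; rewrite invr_ge0.
have -> : vabs x + vabs x = (2 : R) *: vabs x by rewrite scaler_nat mulr2n.
by rewrite scalerA mulVf ?scale1r// pnatr_eq0.
Qed.

Lemma ger0_vabs x : 0 <= x -> vabs x = x.
Proof.
move=> x0; apply/eqP; rewrite eq_le le_vabs andbT /vabs vleUx lexx /=.
have nx0 : - x <= 0 by rewrite -[- x]add0r vl_leBlDr add0r.
exact: le_trans nx0 x0.
Qed.

Lemma vabs0 : vabs (0 : X) = 0. Proof. exact: ger0_vabs. Qed.

Lemma ler_vabsD x y : vabs (x + y) <= vabs x + vabs y.
Proof.
rewrite {1}/vabs vleUx opprD; apply/andP; split; apply: vl_leD;
  by [exact: le_vabs|exact: lenr_vabs].
Qed.

Lemma meet_ge0 x u : 0 <= x -> 0 <= u -> 0 <= vmeet x u.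
Proof. by move=> x0 u0; rewrite vlexI x0. Qed.

Lemma meetDl a b u : 0 <= a -> 0 <= b -> 0 <= u ->
  vmeet (a + b) u <= vmeet a u + vmeet b u.
Proof.
move=> a0 b0 u0; set z := vmeet (a + b) u.
have zab : z <= a + b by exact: vleIl.
have zu : z <= u by exact: vleIr.
have bu0 : 0 <= vmeet b u by exact: meet_ge0.
rewrite -vl_leBlDr vlexI !vl_leBlDr; apply/andP; split.
  rewrite addrC -vl_leBlDr vlexI !vl_leBlDr [b + a]addrC zab /=.
  by rewrite -[z]addr0; apply: vl_leD.
by rewrite -[z]addr0; apply: vl_leD.
Qed.

Lemma solid_le (S : set X) x y : solid S -> 0 <= x -> x <= y -> S y -> S x.
Proof.
move=> sS x0 xy; apply: sS; rewrite !ger0_vabs //.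
exact: le_trans x0 xy.
Qed.

End VectorLatticeTheory.

Definition unbounded (R : realType) (X : locallySolidType R) : Type := X.

Section Unbounded.
Variables (R : realType) (X : locallySolidType R).
Implicit Types (x u : X) (U V : set X).

Definition unb_set U u : set X := [set x | U (vmeet (vabs x) u)].

(* Of all bases at zero made of solid sets, we take the largest; each of them
   gives the same neighbourhoods. *)
Definition unb_nbhs x : set_system X := [set V | exists U u,
  [/\ nbhs 0 U, solid U, 0 <= u & [set y | unb_set U u (y - x)] `<=` V]].

Let unb_nbhs_filter x : ProperFilter (unb_nbhs x).
Proof.
apply: Build_ProperFilter.
  move=> [U [u [U0 sU u0]]] /(_ x); rewrite /unb_set/= subrr vabs0; apply.
  rewrite vmeet0//; exact: nbhs_singleton U0.
split.
- exists setT, 0; split=> //; exact: filterT.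
- move=> P Q [U1 [u1 [U10 sU1 u10 U1P]]] [U2 [u2 [U20 sU2 u20 U2Q]]].
  exists (U1 `&` U2), (vjoin u1 u2); split.
  + exact: filterI.
  + by move=> a b ab [U1b U2b]; split; [exact: sU1 U1b|exact: sU2 U2b].
  + exact: le_trans (vleUl _ _).
  + move=> y [yU1 yU2]; split.
      apply: U1P; apply: solid_le sU1 _ _ yU1; first exact: meet_ge0 (vabs_ge0 _) _.
      by apply: vleI2 => //; exact: vleUl.
    apply: U2Q; apply: solid_le sU2 _ _ yU2; first exact: meet_ge0 (vabs_ge0 _) _.
    by apply: vleI2 => //; exact: vleUr.
- move=> P Q PQ [U [u [U0 sU u0 UP]]]; exists U, u; split=> //.
  exact: subset_trans PQ.
Qed.

Let unb_nbhs_singleton x V : unb_nbhs x V -> V x.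
Proof.
move=> [U [u [U0 sU u0]]]; apply; rewrite /unb_set/= subrr vabs0 vmeet0//; exact: nbhs_singleton U0.
Qed.

Let unb_nbhs_nbhs x V : unb_nbhs x V -> unb_nbhs x (unb_nbhs^~ V).
Proof.
move=> [U [u [U0 sU u0 UV]]].
have := @add_continuous X (0, 0); rewrite /continuous_at/= addr0 => /(_ U U0).
move=> [[W1 W2]/= [W10 W20] W12].
have [W [W0 sW WW]] := solid_base0 _ (filterI W10 W20).
exists W, u; split=> // z zx; exists W, u; split=> // y yz; apply: UV.
have zW : W (vmeet (vabs (z - x)) u) by [].
have yW : W (vmeet (vabs (y - z)) u) by [].
apply: (@solid_le _ _ U _
  (vmeet (vabs (y - z)) u + vmeet (vabs (z - x)) u)) => //.
- exact: meet_ge0 (vabs_ge0 _) _.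
- apply: le_trans (meetDl (vabs_ge0 _) (vabs_ge0 _) u0).
  apply: vleI2 => //; rewrite -[y](subrK z) -addrA [y - z + z]subrK.
  exact: ler_vabsD.
- apply: (W12 (_, _)); split=> /=.
    by have [] := WW _ yW.
  by have [] := WW _ zW.
Qed.

HB.instance Definition _ := Choice.on (unbounded X).
HB.instance Definition _ := hasNbhs.Build (unbounded X) unb_nbhs.
HB.instance Definition _ := @Nbhs_isNbhsTopological.Build (unbounded X)
  unb_nbhs_filter unb_nbhs_singleton unb_nbhs_nbhs.

End Unbounded.

Definition is_metric (R : realType) (T : Type) (d : T -> T -> R) :=
  [/\ forall x y, 0 <= d x y, forall x y, d x y = 0 <-> x = y,
      forall x y, d x y = d y x & forall x y z, d x z <= d x y + d y z].

Definition metrizable (R : realType) (T : topologicalType) :=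
  exists2 d : T -> T -> R, is_metric d &
    forall x : T, nbhs x = filter_from [set e : R | 0 < e]
                                       (fun e => [set y | d x y < e]).

Section Completion.
Variables (R : realType) (X Y : locallySolidType R).

(* [TopologicalLmodule] carries no uniformity: Cauchy filters are those of the
   uniformity induced by the additive group. *)
Definition cauchy_filter (F : set_system Y) := forall U : set Y, nbhs 0 U ->
  exists2 A, F A & forall x y, A x -> A y -> U (x - y).

Definition tvs_complete := forall F : set_system Y,
  ProperFilter F -> cauchy_filter F -> exists y : Y, F --> y.

(* Existence and, up to isomorphism, uniqueness of the completion are classical;
   [j] is the inclusion of X. That [j] is a lattice homomorphism follows. *)
Definition is_completion (j : {linear X -> Y}) :=
  [/\ [/\ injective j & forall x : X, nbhs x = filter_from (nbhs (j x))
                                                   (fun V => j @^-1` V)],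
      dense (range j),
      hausdorff_space Y /\ tvs_complete
    & [set y : Y | 0 <= y] = closure (j @` [set x : X | 0 <= x])].

Definition quasi_interior_point (e : Y) := 0 <= e /\ dense (ideal_gen [set e]).

End Completion.

(* Main.v *)
Require Import Defs.
From HB Require Import structures.
From mathcomp Require Import all_boot all_order all_algebra.
From mathcomp Require Import all_classical all_reals all_analysis.
Import Order.TTheory GRing.Theory Num.Theory.
Import numFieldNormedType.Exports.
Local Open Scope classical_set_scope.
Local Open Scope ring_scope.

Set Implicit Arguments.
Unset Strict Implicit.
Unset Printing Implicit Defensive.

(** All four conditions say, of X or of its completion, that some sequence of
    positive vectors [b n] _exhausts_ the space: for every x >= 0 the excess
    [vpos (x - b n)], the positive part of x - b n, is as close to 0 as one
    likes for a suitable n ([countably_exhausted]).  The excess is what is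
    left of x once its part x /\ b below b is removed, so exhaustion means
    that positive vectors are approximated by vectors dominated by some [b n].

    - Exhaustion is condition (i), in any locally solid space.  An ideal
      containing every [b n] contains every x /\ b n; conversely the ideal
      generated by a_0, a_1, ... consists of the vectors dominated by some
      multiple of some |a_0| + ... + |a_m|
      ([exhausting_ideal_gen], [ideal_gen_exhausting]).
    - Exhaustion gives a countable base of the unbounded topology, since
      x /\ u <= x /\ b + (u - b)^+ lets the [b n] replace all the u >= 0.
      A countable base and separation give a metric
      ([unbounded_metrizable]).
    - Conversely a countable base of the unbounded topology involves only
      countably many vectors u, and their multiples exhaust the space: the
      meet of u with (x - k u)^+ is at most x / k, so (x - k u)^+ tends to 0
      in the unbounded topology, and being bounded by x it tends to 0 for the
      original one ([metrizable_unbounded_exhausted]).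
    - Exhaustion passes from X to its completion because the images of the
      [b n] still exhaust, and back because each vector of an exhausting
      sequence of the completion is a limit of a sequence of positive vectors
      of X, and all the terms of these sequences together exhaust X
      ([completion_exhausted], [exhausted_completion]).
    - In the completion, which has again a countable base at zero, an
      exhausting sequence can be scaled so that it becomes summable; its sum
      dominates a multiple of every [b n], hence is a quasi-interior point
      ([complete_exhausted_quasi_interior]). *)

(** * Positive parts and solid sets in a vector lattice *)

Section TruncatedDifferences.
Variables (R : realType) (X : vectorLatticeType R).
Implicit Types (x y z u v b c : X) (S : set X).

Definition vpos x : X := vjoin x 0.

Lemma vpos_ge0 x : 0 <= vpos x. Proof. exact: vleUr. Qed.

Lemma le_vpos x : x <= vpos x. Proof. exact: vleUl. Qed.

Lemma vpos_le x z : x <= z -> 0 <= z -> vpos x <= z.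
Proof. by move=> xz z0; rewrite /vpos vleUx xz. Qed.

Lemma vl_subr_ge0 x y : (0 <= y - x) = (x <= y).
Proof. by rewrite -(vl_leD2E x 0) add0r subrK. Qed.

Lemma vl_leDl x y : 0 <= y -> x <= x + y.
Proof. by move=> y0; rewrite -[leLHS]addr0; apply: vl_leD. Qed.

Lemma vl_leBl x y : 0 <= y -> x - y <= x.
Proof. by move=> y0; rewrite vl_leBlDr; apply: vl_leDl. Qed.

Lemma vl_ler_wMn2r x y n : x <= y -> x *+ n <= y *+ n.
Proof.
move=> xy; elim: n => [|n IH]; first by rewrite !mulr0n.
by rewrite !mulrS; apply: vl_leD.
Qed.

Lemma vabsN x : vabs (- x) = vabs x.
Proof.
by apply/le_anti; rewrite /vabs opprK !vleUx !vleUl !vleUr.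
Qed.

Lemma ler_vabsB x y : vabs (x - y) <= vabs x + vabs y.
Proof. by rewrite -(vabsN y); exact: ler_vabsD. Qed.

Lemma ler_vabsZ (a : R) x : vabs (a *: x) <= `|a| *: vabs x.
Proof.
have key (c : R) y : 0 <= c -> c *: y <= c *: vabs y.
  move=> c0; rewrite -vl_subr_ge0 -scalerBr; apply: vl_scale_ge0 => //.
  by rewrite vl_subr_ge0 le_vabs.
have [a0|a0] := ger0P a; rewrite {1}/vabs vleUx.
  by rewrite key//= -scalerN -[vabs x]vabsN key.
have na0 : 0 <= - a by rewrite oppr_ge0 ltW.
rewrite -scaleNr (key (- a)) // andbT.
by rewrite -[a in a *: x]opprK scaleNr -scalerN -[vabs x]vabsN key.
Qed.

(** The reason is that x - z dominates both 0 and x - v.  With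
    [le_meet_vpos] this is the decomposition x = x /\ v + (x - v)^+. *)
Lemma meet_vpos_le x v z : z <= x -> z <= v -> z + vpos (x - v) <= x.
Proof.
move=> zx zv; rewrite addrC -[leRHS](subrK z) vl_leD2E.
apply: vpos_le; last by rewrite vl_subr_ge0.
by rewrite vl_leBlDr -addrA; apply: vl_leDl; rewrite addrC vl_subr_ge0.
Qed.

Lemma le_meet_vpos x v : x <= vmeet x v + vpos (x - v).
Proof.
rewrite -vl_leBlDr vlexI vl_leBl ?vpos_ge0//=.
by rewrite vl_leBlDr addrC -vl_leBlDr le_vpos.
Qed.

(** This is what lets a single vector b replace u in the neighbourhoods of the
    unbounded topology when u exceeds b by little. *)
Lemma meet_le_meet_vpos x u b : vmeet x u <= vmeet x b + vpos (u - b).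
Proof.
rewrite -vl_leBlDr vlexI; apply/andP; split.
  exact: le_trans (vl_leBl _ (vpos_ge0 _)) (vleIl _ _).
rewrite vl_leBlDr; apply: le_trans (vleIr _ _) _.
by rewrite addrC -vl_leBlDr le_vpos.
Qed.

(** Morally, u meets (x - k u)^+ only where x >= k u.  In an arbitrary vector
    lattice, with c the meet, i c <= x for i <= k by induction: if i c <= x
    then i c <= x /\ i u, which leaves the room
    (x - i u)^+ >= (x - k u)^+ >= c below x. *)
Lemma meet_vpos_mulrn_le x u k : 0 <= x -> 0 <= u ->
  vmeet (vpos (x - u *+ k)) u *+ k <= x.
Proof.
move=> x0 u0; set c := vmeet _ _.
suff H i : (i <= k)%N -> c *+ i <= x by exact: H.
elim: i => [|i IH] ik; first by rewrite mulr0n.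
rewrite mulrSr; apply: le_trans (meet_vpos_le (IH (ltnW ik)) _).
  apply: vl_leD => //; apply: le_trans (vleIl _ _) _.
  apply: vpos_le; last exact: vpos_ge0.
  apply: le_trans (le_vpos _); rewrite vl_leBlDr -addrA; apply: vl_leDl.
  rewrite addrC vl_subr_ge0 -(subnK (ltnW ik)) mulrnDr addrC.
  by apply: vl_leDl; rewrite -(mul0rn _ (k - i)); exact: vl_ler_wMn2r.
by apply: vl_ler_wMn2r; exact: vleIr.
Qed.

Lemma solid_abs S x y : solid S -> vabs x <= y -> S y -> S x.
Proof.
move=> sS xy; apply: sS; apply: le_trans xy _; exact: le_vabs.
Qed.

Lemma solidN S x : solid S -> S x -> S (- x).
Proof. by move=> sS; apply: sS; rewrite vabsN. Qed.

Lemma order_ideal_gen (A : set X) : order_ideal (ideal_gen A).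
Proof.
split.
- by move=> M [[]].
- move=> x y Sx Sy M [iM AM]; have [_ + _ _] := iM.
  by apply; [exact: Sx|exact: Sy].
- by move=> a x Sx M [iM AM]; have [_ _ + _] := iM; apply; exact: Sx.
- move=> x y xy Sy M [iM AM]; have [_ _ _] := iM.
  by apply; [exact: xy|exact: Sy].
Qed.

End TruncatedDifferences.

(** * Topological groups, countable bases and metrics *)

Section TopologicalGroup.
Variable M : topologicalZmodType.
Implicit Types (x y : M) (U : set M).

Lemma nbhs0_add U : nbhs 0 U ->
  exists2 W, nbhs 0 W & forall x y, W x -> W y -> U (x + y).
Proof.
move=> U0; have := @add_continuous M (0, 0).
rewrite /continuous_at/= addr0 => /(_ U U0)[[A B]/= [A0 B0] AB].
exists (A `&` B); first exact: filterI.
by move=> x y [Ax _] [_ By]; exact: (AB (x, y)).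
Qed.

Lemma nbhs_addl x y U : nbhs (x + y) U -> nbhs y [set z | U (x + z)].
Proof.
move=> Uxy; have := @add_continuous M (x, y) U Uxy.
move=> [[A B]/= [Ax By] AB]; apply: filterS By => z Bz.
by apply: (AB (x, z)); split => //=; exact: nbhs_singleton Ax.
Qed.

Lemma nbhs_subr x U : nbhs 0 U -> nbhs x [set y | U (y - x)].
Proof.
move=> U0; have := @nbhs_addl (- x) x U.
rewrite addNr => /(_ U0); apply: filterS => y /=.
by rewrite addrC.
Qed.

Lemma closure_nbhs0P (S : set M) x :
  closure S x <-> forall U, nbhs 0 U -> exists2 s, S s & U (s - x).
Proof.
split=> [Sx U /(nbhs_subr x)/Sx [s [Ss Us]]|H V Vx]; first by exists s.
have := @nbhs_addl x 0 V; rewrite addr0 => /(_ Vx)/H [s Ss /=].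
by rewrite addrC subrK => Vs; exists s.
Qed.

End TopologicalGroup.

Lemma dense_closureP (T : topologicalType) (S : set T) :
  dense S <-> closure S = setT.
Proof.
split=> [dS|cS V [x Vx] oV].
  apply/seteqP; split => // x _ B.
  rewrite nbhsE => -[V [oV Vx] VB].
  have [y [Vy Sy]] := dS V (ex_intro _ x Vx) oV.
  by exists y; split => //; exact: VB.
have : closure S x by rewrite cS.
move=> /(_ V (open_nbhs_nbhs (conj oV Vx))) [y [Sy Vy]].
by exists y.
Qed.

Definition countable_base_at (T : topologicalType) (x : T) :=
  exists2 B : nat -> set T, forall n, nbhs x (B n) &
    forall U, nbhs x U -> exists n, B n `<=` U.

Lemma metrizable_base_at (R : realType) (T : topologicalType) (x : T) :
  metrizable R T -> countable_base_at x.
Proof.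
move=> [d _ nbhsd]; exists (fun n => [set y | d x y < n.+1%:R^-1]).
  by move=> n; rewrite nbhsd; exists n.+1%:R^-1 => //=.
move=> U; rewrite nbhsd => -[e /= e0 eU]; exists (Num.truncn e^-1) => y /= dy.
apply: eU => /=; apply: lt_le_trans dy _.
by rewrite -[leRHS]invrK lef_pV2 ?posrE ?invr_gt0// ltW// truncnS_gt.
Qed.

Lemma metrizable_hausdorff (R : realType) (T : topologicalType) :
  metrizable R T -> hausdorff_space T.
Proof.
move=> [d [d0 dE dC dT] nbhsd] x y xy; apply/dE; apply/eqP.
rewrite eq_le d0 andbT leNgt; apply/negP => dxy.
have h : 0 < d x y / 2 by rewrite divr_gt0.
have nb z : nbhs z [set t | d z t < d x y / 2].
  by rewrite nbhsd; exists (d x y / 2).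
have [z [/= xz yz]] := xy _ _ (nb x) (nb y).
have := dT x z y; rewrite leNgt => /negP; apply.
by rewrite [ltRHS]splitr; apply: ltrD => //; rewrite dC.
Qed.

(** The countable base of entourages provides a pseudometric given by its
    balls; the distance is recovered as the infimum of the radii of the balls
    around one point that contain the other.  It is finite because every ball
    of radius 2 is the whole space. *)
Lemma uniform_metrizable (R : realType) (T : uniformType) :
  countable_uniformity T -> hausdorff_space T -> metrizable R T.
Proof.
move=> cT hT; pose P : pseudoMetricType R := countable_uniform.type cT.
pose E (x y : P) : set R := [set e : R | 0 < e /\ ball x e y].
have E2 x y : E x y 2.
  split => //.
  exact: (@countable_uniform.countable_uniform_bounded R T cT x y).
have Elb x y : has_inf (E x y).
  by split; [exists 2|exists 0 => e [/ltW]].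
pose d (x y : P) : R := inf (E x y).
have dlt x y e : 0 < e -> d x y < e -> ball x e y.
  move=> e0 /(inf_lt (Elb x y).1) [e' [_ be'] /ltW e'e].
  exact: le_ball be'.
have led x y e : 0 < e -> ball x e y -> d x y <= e.
  by move=> e0 be; apply: ge_inf; [exact: (Elb x y).2|split].
have d0 x y : 0 <= d x y.
  by apply: lb_le_inf; [exact: (Elb x y).1|move=> e [/ltW]].
exists d; first split => //.
- move=> x y; split=> [dxy|->].
    apply: hT; suff : cluster (nbhs (x : P)) y by [].
    move=> A B /nbhs_ballP[a /= a0 aA] /nbhs_ballP[b /= b0 bB].
    exists y; split; last by apply: bB; exact: ballxx.
    by apply/aA/dlt => //; rewrite dxy.
  apply/eqP; rewrite eq_le d0 andbT; apply/ler_addgt0Pl => e e0.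
  by rewrite addr0; apply: led => //; exact: ballxx.
- move=> x y; congr inf; apply/seteqP.
  by split=> e [e0 b]; split => //; exact: ball_sym.
- move=> x y z; apply/ler_addgt0Pl => e e0.
  have -> : e + (d x y + d y z) = (d x y + e / 2) + (d y z + e / 2).
    by rewrite [RHS]addrACA -splitr addrC.
  have h : 0 < e / 2 by rewrite divr_gt0.
  have p u v : 0 < d u v + e / 2 by rewrite ltr_wpDl.
  apply: led; first by rewrite addr_gt0.
  by apply: (@ball_triangle R P y); apply: dlt => //; rewrite ltrDl.
- move=> x; have -> : nbhs x = nbhs (x : P) by [].
  apply/seteqP; split=> V /=.
    move=> /nbhs_ballP[e /= e0 eV]; exists e => //= y dy.
    by apply: eV; exact: dlt.
  move=> [e /= e0 eV]; apply/nbhs_ballP; exists (e / 2) => /=.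
    by rewrite divr_gt0.
  move=> y bxy; apply: eV => /=; apply: le_lt_trans (led _ _ _ _ bxy) _.
    by rewrite divr_gt0.
  by rewrite ltr_pdivrMr// ltr_pMr// ltr1n.
Qed.

(** * Exhausting families in a locally solid space *)

Section LocallySolidTheory.
Variables (R : realType) (Y : locallySolidType R).
Implicit Types (x y z u v : Y) (U V W S : set Y).

Lemma solid_nbhs0_add U : nbhs 0 U -> exists W, [/\ nbhs 0 W, solid W,
  W `<=` U & forall x y, W x -> W y -> U (x + y)].
Proof.
move=> U0; have [V V0 VU] := nbhs0_add U0.
have [W [W0 sW WV]] := solid_base0 _ (filterI U0 V0).
exists W; split => // [x /WV[]//|x y /WV[_ Vx] /WV[_ Vy]]; exact: VU.
Qed.

Lemma nbhs0_scale_inv U x : nbhs 0 U -> exists n, U (n.+1%:R^-1 *: x).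
Proof.
move=> U0; have := @scale_continuous R Y (0, x).
rewrite /continuous_at/= scale0r => /(_ U U0)[[A B]/= [A0 Bx] AB].
have : nbhs (0 : R) A by [].
move=> /nbhs_ballP[e /= e0 eA]; exists (Num.truncn e^-1).
apply: (AB (_, x)); split => /=; last exact: nbhs_singleton Bx.
apply: eA; rewrite /ball/= sub0r normrN ger0_norm ?invr_ge0//.
by rewrite -[ltRHS]invrK ltf_pV2 ?posrE ?invr_gt0// truncnS_gt.
Qed.

Lemma closure_ideal_sub S x y : order_ideal S ->
  closure S x -> closure S y -> closure S (x - y).
Proof.
move=> [_ SD SZ _] /closure_nbhs0P Sx /closure_nbhs0P Sy.
apply/closure_nbhs0P => U /solid_nbhs0_add[W [W0 sW _ WU]].
have [s Ss Ws] := Sx W W0; have [t St Wt] := Sy W W0.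
exists (s - t); first by apply: SD => //; rewrite -scaleN1r; exact: SZ.
by rewrite opprD addrACA -opprD; apply: WU => //; exact: solidN.
Qed.

Lemma closure_idealP S : order_ideal S ->
  (forall x, 0 <= x -> closure S x) -> closure S = setT.
Proof.
move=> iS H; apply/seteqP; split => // x _.
have -> : x = vabs x - (vabs x - x) by rewrite opprB addrC subrK.
by apply: closure_ideal_sub => //; apply: H;
  rewrite ?vabs_ge0// vl_subr_ge0 le_vabs.
Qed.

Lemma hausdorff_sep x : hausdorff_space Y ->
  (forall U, nbhs 0 U -> U x) -> x = 0.
Proof.
move=> hY H; apply: hY => A B Ax B0.
exists x; split; [exact: nbhs_singleton Ax|exact: H].
Qed.

(** The positive part is used, and not an approximation of x by vectors
    between -b and b, because it is an explicit monotone function of x and b: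
    it can be compared with its counterpart in another space along a positive
    linear map. *)
Definition exhausting (I : Type) (b : I -> Y) :=
  (forall i, 0 <= b i) /\
  forall x, 0 <= x -> forall U, nbhs 0 U -> exists i, U (vpos (x - b i)).

Definition countably_exhausted := exists b : nat -> Y, exhausting b.

(** Families indexed by pairs arise whenever a sequence is combined with the
    multiples of its terms or with a countable base. *)
Lemma exhausting_count (I : countType) (b : I -> Y) :
  exhausting b -> countably_exhausted.
Proof.
move=> [b0 bx]; exists (fun n => if unpickle n is Some i then b i else 0).
split=> [n|x x0 U U0]; first by case: unpickle.
by have [i Ui] := bx x x0 U U0; exists (pickle i); rewrite pickleK.
Qed.

Lemma exhausting_ideal_dense (I : Type) (b : I -> Y) S :
  exhausting b -> order_ideal S -> (forall i, S (b i)) -> closure S = setT.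
Proof.
move=> [b0 bx] iS Sb; apply: closure_idealP => // x x0.
apply/closure_nbhs0P => U U0; have [W [W0 sW WU]] := solid_base0 _ U0.
have [i Wi] := bx x x0 W W0; have [_ _ _ sS] := iS.
exists (vmeet x (b i)).
  apply: solid_le sS _ _ (Sb i); [exact: meet_ge0|exact: vleIr].
apply: WU; rewrite -opprB; apply: solidN => //; apply: solid_le sW _ _ Wi.
  by rewrite vl_subr_ge0 vleIl.
by rewrite vl_leBlDr addrC le_meet_vpos.
Qed.

Lemma exhausting_ideal_gen : countably_exhausted ->
  exists2 A : set Y, countable A & closure (ideal_gen A) = setT.
Proof.
move=> [b eb]; exists (range b).
  exact: card_le_trans (card_image_le _ _) (countableP _).
apply: exhausting_ideal_dense eb (order_ideal_gen _) _ => i M [_]; apply.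
by exists i.
Qed.

(** The multiples of the partial sums |a_0| + ... + |a_(m-1)| exhaust: the
    vectors dominated by one of them form an ideal containing A, and if z is
    dominated by b, then (x - b)^+ <= |x - z|. *)
Lemma ideal_gen_exhausting (A : set Y) : countable A ->
  closure (ideal_gen A) = setT -> countably_exhausted.
Proof.
move=> /countable_injP[c cinj] clA.
(* A may be empty, so that the enumeration takes the value 0 outside the
   codes of elements of A. *)
pose f n : Y := if pselect (exists2 a, A a & c a = n) is left h
  then sval (cid2 h) else 0.
have fc a : A a -> f (c a) = a.
  move=> Aa; rewrite /f; case: pselect => [h|[]]; last by exists a.
  by case: cid2 => a' /= Aa' /cinj; apply; rewrite inE.
pose s n : Y := \sum_(i < n) vabs (f i).
have s0 n : 0 <= s n.
  elim: n => [|n IH]; rewrite /s ?big_ord0// big_ord_recr/=.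
  by apply: le_trans IH _; exact/vl_leDl/vabs_ge0.
have smono m k : s m <= s (m + k)%N.
  elim: k => [|k IH]; first by rewrite addn0.
  rewrite addnS; apply: le_trans IH _; rewrite [leRHS]/s big_ord_recr/=.
  exact/vl_leDl/vabs_ge0.
apply: (@exhausting_count (nat * nat)%type (fun p => s p.1 *+ p.2)).
split=> [p|x x0 U U0].
  by rewrite -(mul0rn _ p.2); exact: vl_ler_wMn2r.
have [W [W0 sW WU]] := solid_base0 _ U0.
have : closure (ideal_gen A) x by rewrite clA.
move=> /closure_nbhs0P/(_ W W0)[z + Wz].
move/(_ [set z | exists p, vabs z <= s p.1 *+ p.2]) => []; first split.
- split.
  + by exists (0, 0)%N; rewrite vabs0 mulr0n.
  + move=> y t [[m k]/= ymk] [[m' k']/= tmk]; exists (m + m', k + k')%N => /=.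
    apply: le_trans (ler_vabsD _ _) _; rewrite mulrnDr; apply: vl_leD.
      exact/(le_trans ymk)/vl_ler_wMn2r.
    by apply/(le_trans tmk)/vl_ler_wMn2r; rewrite addnC.
  + move=> a y [[m k]/= ymk]; exists (m, k * (Num.truncn `|a|).+1)%N => /=.
    apply: le_trans (ler_vabsZ _ _) _; rewrite mulrnA.
    apply: (@le_trans _ _ (vabs y *+ (Num.truncn `|a|).+1)); last first.
      exact: vl_ler_wMn2r.
    rewrite -scaler_nat -vl_subr_ge0 -scalerBl; apply: vl_scale_ge0.
      by rewrite subr_ge0 ltW// truncnS_gt.
    exact: vabs_ge0.
  + by move=> y t yt [p tp]; exists p; exact: le_trans tp.
- move=> a Aa; exists ((c a).+1, 1%N) => /=.
  rewrite mulr1n /s big_ord_recr/= fc// addrC.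
  by apply: vl_leDl; exact: s0.
- move=> p zp; exists p; apply: WU.
  apply: sW Wz; rewrite ger0_vabs ?vpos_ge0//.
  rewrite -[vabs (z - x)]vabsN opprB; apply: vpos_le; last exact: vabs_ge0.
  apply: le_trans (le_vabs _); apply: vl_leD => //.
  rewrite -vl_subr_ge0 opprK addrC vl_subr_ge0.
  exact: le_trans (le_vabs _) zp.
Qed.

End LocallySolidTheory.

(** * Metrizability of the unbounded topology *)

Section UnboundedUniformity.
Variables (R : realType) (Y : locallySolidType R).
Implicit Types (x y u : Y) (U : set Y).

Definition unb_rel U u : set (Y * Y) := [set p | unb_set U u (p.2 - p.1)].

Definition unb_entourage : set_system (unbounded Y * unbounded Y) :=
  [set E | exists U u, [/\ nbhs 0 U, solid U, 0 <= u & unb_rel U u `<=` E]].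

Let ent_filter : Filter unb_entourage.
Proof.
split.
- by exists setT, 0; split => //; exact: filterT.
- move=> P Q [U [u [U0 sU u0 UP]]] [V [v [V0 sV v0 VQ]]].
  exists (U `&` V), (vjoin u v); split.
  + exact: filterI.
  + by move=> a b ab [Ub Vb]; split; [exact: sU Ub|exact: sV Vb].
  + exact: le_trans u0 (vleUl _ _).
  + move=> p [Up Vp]; split.
      apply: UP; apply: solid_le sU _ _ Up.
        exact: meet_ge0 (vabs_ge0 _) _.
      by apply: vleI2 => //; exact: vleUl.
    apply: VQ; apply: solid_le sV _ _ Vp; first exact: meet_ge0 (vabs_ge0 _) _.
    by apply: vleI2 => //; exact: vleUr.
- move=> P Q PQ [U [u [U0 sU u0 UP]]]; exists U, u; split => //.
  exact: subset_trans PQ.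
Qed.

Let ent_diagonal E : unb_entourage E -> diagonal `<=` E.
Proof.
move=> [U [u [U0 sU u0 UE]]] [x y]; rewrite /diagonal/= => ->; apply: UE.
by rewrite /unb_rel/unb_set/= subrr vabs0 vmeet0//; exact: nbhs_singleton U0.
Qed.

Let ent_inv E : unb_entourage E -> unb_entourage (E^-1)%relation.
Proof.
move=> [U [u [U0 sU u0 UE]]]; exists U, u; split => // -[x y] Uxy.
by apply: UE; move: Uxy; rewrite /unb_rel/unb_set/= -vabsN opprB.
Qed.

Let ent_split E : unb_entourage E ->
  exists2 F, unb_entourage F & (F \; F)%relation `<=` E.
Proof.
move=> [U [u [U0 sU u0 UE]]]; have [W [W0 sW _ WU]] := solid_nbhs0_add U0.
exists (unb_rel W u); first by exists W, u; split.
move=> [x z] [y /= xy yz]; apply: UE; rewrite /unb_rel/unb_set/=.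
apply: solid_le sU _ _ (WU _ _ xy yz); first exact: meet_ge0 (vabs_ge0 _) _.
apply: le_trans (meetDl (vabs_ge0 _) (vabs_ge0 _) u0).
apply: vleI2 => //; apply: le_trans (ler_vabsD _ _).
by rewrite [X in _ <= vabs X]addrC addrA subrK.
Qed.

Let ent_nbhs : nbhs = nbhs_ unb_entourage :> (unbounded Y -> _).
Proof.
apply/funext => x; apply/seteqP; split=> V /=.
  move=> [U [u [U0 sU u0 UV]]]; exists (unb_rel U u).
    by exists U, u; split.
  by move=> y; rewrite /xsection/= inE; exact: UV.
move=> [E [U [u [U0 sU u0 UE]]] EV]; exists U, u; split => // y Uy.
by apply: EV; rewrite /xsection/= inE; exact: UE.
Qed.

(** The uniformity of the additive group, which induces the topology of the
    unbounded space. *)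
HB.instance Definition _ := Nbhs_isUniform_mixin.Build (unbounded Y)
  ent_filter ent_diagonal ent_inv ent_split ent_nbhs.

(** The truncation level |y - x| separates x from y, as it does not alter the
    difference y - x. *)
Lemma unbounded_hausdorff : hausdorff_space Y -> hausdorff_space (unbounded Y).
Proof.
move=> hY x y xy; apply/esym/eqP; rewrite -subr_eq0; apply/eqP.
apply: (hausdorff_sep hY) => U U0.
have [V [V0 sV VU]] := solid_base0 _ U0; apply: VU.
have [W [W0 sW _ WV]] := solid_nbhs0_add V0.
pose v : Y := vabs ((y : Y) - x); have v0 : 0 <= v by exact: vabs_ge0.
have [||z [xz yz]] := xy [set z | unb_set W v (z - x)]
  [set z | unb_set W v (z - y)].
- by exists W, v; split.
- by exists W, v; split.
apply: solid_abs sV _ (WV _ _ xz yz); rewrite -/v.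
apply: le_trans (meetDl (vabs_ge0 _) (vabs_ge0 _) v0).
rewrite vlexI lexx andbT; apply: le_trans (ler_vabsB _ _).
by rewrite opprB [X in _ <= vabs X]addrC addrA subrK.
Qed.

(** Given U and u, choose W + W inside U, then b with (u - b)^+ in W: every x
    such that |x| /\ b is in W has |x| /\ u in U. *)
Lemma unbounded_metrizable : hausdorff_space Y -> countable_base_at (0 : Y) ->
  countably_exhausted Y -> metrizable R (unbounded Y).
Proof.
move=> hY [B B0 BU] [b [b0 bx]].
have /choice[V HV] : forall n, exists V : set Y,
    [/\ nbhs 0 V, solid V & V `<=` B n] by move=> n; exact: solid_base0.
apply: uniform_metrizable (unbounded_hausdorff hY).
exists (range (fun p : nat * nat => unb_rel (V p.1) (b p.2))); split.
- exact: card_le_trans (card_image_le _ _) (countableP _).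
- move=> _ [[n i] _ <-] /=; exists (V n), (b i).
  by have [? ? _] := HV n; split.
- move=> E [U [u [U0 sU u0 UE]]].
  have [W [W0 sW _ WU]] := solid_nbhs0_add U0.
  have [n nW] := BU W W0; have [i Wi] := bx u u0 W W0.
  exists (unb_rel (V n) (b i)); first by exists (n, i).
  move=> p Vp; apply: UE.
  have Wp : W (vmeet (vabs (p.2 - p.1)) (b i)).
    by apply: nW; have [_ _] := HV n; apply.
  apply: solid_le sU _ _ (WU _ _ Wp Wi); first exact: meet_ge0 (vabs_ge0 _) _.
  exact: meet_le_meet_vpos.
Qed.

(** A countable base gives pairs (U_n, u_n) such that, for x >= 0 and W solid,
    |y| /\ u_n in U_n implies |y| /\ x in W for some n.  This is applied to
    y = (x - k u_n)^+, for which y /\ u_n <= x / k and y /\ x = y. *)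
Lemma metrizable_unbounded_exhausted :
  metrizable R (unbounded Y) -> countably_exhausted Y.
Proof.
move=> /(@metrizable_base_at R (unbounded Y) (0 : Y))[B B0 BU].
have /choice[Uu HU] : forall n, exists p : set Y * Y,
    [/\ nbhs 0 p.1, 0 <= p.2 & unb_set p.1 p.2 `<=` B n].
  move=> n; have [U [u [U0 sU u0 UB]]] := B0 n; exists (U, u); split => // x Ux.
  by apply: UB; rewrite /= subr0.
apply: (@exhausting_count _ _ (nat * nat)%type
  (fun p => (Uu p.1).2 *+ p.2)).
split=> [[n k]/=|x x0 U U0].
  by have [_ u0 _] := HU n; rewrite -(mul0rn _ k); exact: vl_ler_wMn2r.
have [W [W0 sW WU]] := solid_base0 _ U0.
have [n nW] : exists n, B n `<=` unb_set W x.
  by apply: BU; exists W, x; split => // y; rewrite /= subr0.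
have [n0 u0 nB] := HU n; set u := (Uu n).2 in u0 nB.
have [k Uk] : exists k, (Uu n).1 (vmeet (vpos (x - u *+ k)) u).
  have [G [G0 sG GU]] := solid_base0 _ n0.
  have [k Gk] := nbhs0_scale_inv x G0; exists k.+1.
  apply: GU; apply: solid_le sG _ _ Gk; first exact: meet_ge0 (vpos_ge0 _) _.
  rewrite -vl_subr_ge0 -[vmeet _ _](@scalerK _ _ (k.+1%:R : R)) ?pnatr_eq0//.
  rewrite -scalerBr; apply: vl_scale_ge0; first by rewrite invr_ge0.
  by rewrite scaler_nat vl_subr_ge0; exact: meet_vpos_mulrn_le.
exists (n, k); apply: WU => /=; rewrite -/u.
have p0 := vpos_ge0 (x - u *+ k).
have : unb_set W x (vpos (x - u *+ k)).
  by apply: nW; apply: nB; rewrite /unb_set/= ger0_vabs.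
rewrite /unb_set/= ger0_vabs// => Wp; apply: solid_le sW p0 _ Wp.
rewrite vlexI lexx/=; apply: vpos_le => //; apply: vl_leBl.
by rewrite -(mul0rn _ k); exact: vl_ler_wMn2r.
Qed.

End UnboundedUniformity.

(** * Quasi-interior points of a complete space *)

Section QuasiInterior.
Variables (R : realType) (Y : locallySolidType R).
Implicit Types (x y e : Y) (U V : set Y).

Lemma quasi_interior_exhausted e :
  quasi_interior_point e -> countably_exhausted Y.
Proof.
move=> [e0 /dense_closureP]; apply: ideal_gen_exhausting; exact: countable1.
Qed.

(** With V_(n+1) + V_(n+1) inside V_n, terms c_i in V_(i+1) have all their sums
    over n <= i < m in V_n, so that the partial sums form a Cauchy sequence as
    soon as the V_n refine a base. *)
Lemma summable_scaling (b : nat -> Y) : countable_base_at (0 : Y) ->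
  tvs_complete Y ->
  exists l : nat -> R, (forall n, 0 < l n) /\
    exists e : Y, (fun n => \sum_(i < n) l i *: b i) @ \oo --> e.
Proof.
move=> [B B0 BU] cY.
have /choice[h Hh] : forall U, exists W : set Y, nbhs 0 U ->
    [/\ nbhs 0 W, solid W & forall x y, W x -> W y -> U (x + y)].
  move=> U; have [U0|nU] := pselect (nbhs 0 U); last by exists U.
  by have [W [W0 sW _ WU]] := solid_nbhs0_add U0; exists W.
pose V := fix V n := if n is m.+1 then h (V m `&` B m) else setT.
have V0 n : nbhs 0 (V n).
  elim: n => [|n IH]; first exact: filterT.
  by have [] := Hh _ (filterI IH (B0 n)).
have HV n : [/\ solid (V n.+1), forall x y, V n.+1 x -> V n.+1 y -> V n (x + y)
    & forall x y, V n.+1 x -> V n.+1 y -> B n (x + y)].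
  have [_ sV VV] := Hh _ (filterI (V0 n) (B0 n)).
  by split => // x y Vx Vy; have [] := VV _ _ Vx Vy.
have /choice[k Hk] : forall n, exists k, V n.+1 (k.+1%:R^-1 *: b n).
  by move=> n; exact: nbhs0_scale_inv.
pose l n : R := (k n).+1%:R^-1; exists l.
split=> [n|]; first by rewrite invr_gt0.
pose s n := \sum_(i < n) l i *: b i.
have tail m n : V n (\sum_(n <= i < n + m) l i *: b i).
  elim: m n => [|m IH] n.
    by rewrite addn0 big_geq//; exact: nbhs_singleton (V0 n).
  rewrite big_ltn ?addnS ?ltnS ?leq_addr// -addSn.
  by have [_ + _] := HV n; apply; [exact: Hk|exact: IH].
have sB n m : (n <= m)%N -> V n (s m - s n).
  move=> nm; have := tail (m - n)%N n; rewrite subnKC//.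
  suff -> : s m = s n + \sum_(n <= i < m) l i *: b i by rewrite addrC addKr.
  rewrite /s -!(big_mkord xpredT (fun i => l i *: b i)).
  by rewrite (@big_cat_nat _ _ _ n).
apply: cY => U /BU[n nU].
exists (s @` [set m | (n.+2 <= m)%N]).
  by exists n.+2 => // m /= nm; exists m.
move=> _ _ [m nm <-] [m' nm' <-].
have [sV VV _] := HV n.+1; have [_ _ VB] := HV n.
apply: nU; have -> : s m - s m' = (s m - s n.+2) + (s n.+2 - s m').
  by rewrite addrA subrK.
have V1 x : V n.+2 x -> V n.+1 x.
  move=> Vx; rewrite -[x]addr0; apply: VV => //.
  exact: nbhs_singleton (V0 _).
apply: VB; apply: V1; first exact: sB.
by rewrite -opprB; apply: solidN => //; exact: sB.
Qed.

(** The closedness of the cone makes the sum of a positive series dominate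
    each of its terms. *)
Lemma complete_exhausted_quasi_interior : countable_base_at (0 : Y) ->
  tvs_complete Y -> closed [set y : Y | 0 <= y] -> countably_exhausted Y ->
  exists e : Y, quasi_interior_point e.
Proof.
move=> bY cY clY [b eb]; have [b0 _] := eb.
have [l [l0 [e se]]] := summable_scaling b bY cY.
have lb0 n : 0 <= l n *: b n by apply: vl_scale_ge0 => //; exact: ltW.
have le_e n : l n *: b n <= e.
  rewrite -vl_subr_ge0; apply: clY; apply/closure_nbhs0P => U U0.
  have [N _ HN] := se _ (nbhs_subr e U0).
  exists (\sum_(i < (N + n).+1) l i *: b i - l n *: b n); last first.
    by rewrite opprB addrA subrK; apply: HN; rewrite /= -addnS leq_addr.
  rewrite /= (bigD1 (Ordinal (leq_addl N n : n < (N + n).+1)%N))//=.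
  rewrite addrAC subrr add0r.
  elim/big_ind: _ => // x y x0 y0; exact: le_trans x0 (vl_leDl _ y0).
exists e; split; first exact: le_trans (le_e 0).
apply/dense_closureP.
apply: exhausting_ideal_dense eb (order_ideal_gen _) _ => n.
have -> : b n = (l n)^-1 *: (l n *: b n).
  by rewrite scalerA mulVf ?scale1r// gt_eqF.
have [_ _ SZ sS] := order_ideal_gen [set e].
by apply: SZ; apply: solid_le sS _ (le_e n) _ => // M [_]; apply.
Qed.

End QuasiInterior.

(** * Exhausting families of the completion *)

Section Completion.
Variables (R : realType) (X Y : locallySolidType R) (j : {linear X -> Y}).
Hypothesis jY : is_completion j.

Let j_nbhs0 (U : set X) :
  nbhs 0 U <-> exists2 V : set Y, nbhs 0 V & j @^-1` V `<=` U.
Proof.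
have [[_ nj] _ _ _] := jY; rewrite nj linear0.
by split=> -[V V0 VU]; exists V.
Qed.

Let j_approx (y : Y) U : 0 <= y -> nbhs 0 U -> exists2 x, 0 <= x & U (j x - y).
Proof.
have [_ _ _ cone] := jY => y0 U0.
have : closure (j @` [set x : X | 0 <= x]) y by rewrite -cone.
by move=> /closure_nbhs0P/(_ U U0)[_ [x x0 <-] Uxy]; exists x.
Qed.

Let j_ge0 x : 0 <= x -> 0 <= j x.
Proof.
have [_ _ _ cone] := jY => x0; suff : [set y | 0 <= y] (j x) by [].
by rewrite cone; apply: subset_closure; exists x.
Qed.

(** The closures of the images of a base of X: they are neighbourhoods because
    X is dense, and they are small because 0 has a base of closed
    neighbourhoods. *)
Lemma completion_base : countable_base_at (0 : X) -> countable_base_at (0 : Y).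
Proof.
move=> [B B0 BU]; exists (fun n => closure (j @` B n)) => [n|U U0].
  have /j_nbhs0[V V0 VB] := B0 n; have [_ dj _ _] := jY.
  apply: filterS (nbhs_interior V0) => y Vy W Wy.
  have : (V° `&` W°) !=set0 by exists y; split => //; exact: nbhs_interior.
  move=> /dj[|z [VW [x _ xz]]]; first by apply: openI; exact: open_interior.
  move: VW; rewrite -xz => -[Vz Wz].
  exists (j x); split; last exact: interior_subset Wz.
  by exists x => //; apply: VB; exact: interior_subset Vz.
have [W [W0 sW _ WU]] := solid_nbhs0_add U0.
have [n nW] : exists n, B n `<=` j @^-1` W.
  by apply: BU; apply/j_nbhs0; exists W.
exists n => y /closure_nbhs0P/(_ W W0)[_ [x Bx <-] Wxy].
rewrite -[y](subKr (j x)); apply: WU; first exact: nW.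
exact: solidN.
Qed.

(** If j x is close to y and b exhausts x, then (y - j b)^+ is dominated by
    |j x - y| + j ((x - b)^+). *)
Lemma completion_exhausted : countably_exhausted X -> countably_exhausted Y.
Proof.
move=> [b [b0 bx]]; exists (j \o b); split=> [n|y y0 U U0]; first exact: j_ge0.
have [V [V0 sV VU]] := solid_base0 _ U0.
have [W [W0 sW _ WU]] := solid_nbhs0_add V0.
have [x x0 Wxy] := j_approx y0 W0.
have [n Wn] : exists n, W (j (vpos (x - b n))).
  by apply: (bx x x0 (j @^-1` W)); apply/j_nbhs0; exists W.
exists n; apply: VU; apply: solid_le sV (vpos_ge0 _) _
  (WU _ _ (_ : W (vabs (j x - y))) Wn); last first.
  by apply: sW Wxy; rewrite [vabs (vabs _)]ger0_vabs// vabs_ge0.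
apply: vpos_le; last first.
  by apply: le_trans (vabs_ge0 _) (vl_leDl _ _); exact/j_ge0/vpos_ge0.
have -> : y - j (b n) = - (j x - y) + j (x - b n).
  by rewrite (linearB j) opprB addrA subrK.
apply: vl_leD; first exact: lenr_vabs.
by rewrite -vl_subr_ge0 -(linearB j); apply: j_ge0; rewrite vl_subr_ge0 le_vpos.
Qed.

(** Let w = (j x - b)^+ be small and let c >= 0 in X have j c close to b.
    Approximate w and w - (j x - b), both positive, by j p and j q with p and q
    positive.  Then p is small because w is, and r = (x - c) - (p - q) is small
    because j r is; hence so is (x - c)^+ <= p + |r|.  Working with p and q
    avoids comparing the lattice operations of the two spaces. *)
Lemma exhausted_completion : countable_base_at (0 : Y) ->
  countably_exhausted Y -> countably_exhausted X.
Proof.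
move=> [B B0 BU] [b [b0 bx]].
have /choice[a Ha] : forall p : nat * nat,
    exists x, 0 <= x /\ B p.2 (j x - b p.1).
  by move=> p; have [x x0 Bx] := j_approx (b0 p.1) (B0 p.2); exists x.
apply: (@exhausting_count _ _ (nat * nat)%type a).
split=> [p|x x0 U U0]; first by have [] := Ha p.
have [U1 [U10 sU1 U1U]] := solid_base0 _ U0.
have [V [V0 sV _ VU]] := solid_nbhs0_add U10.
have /j_nbhs0[V' V'0 V'V] := V0.
have [W [W0 sW WV' WV]] := solid_nbhs0_add V'0.
have [G [G0 sG GW' GW]] := solid_nbhs0_add W0.
have [n Gn] := bx _ (j_ge0 x0) G G0; set w := vpos _ in Gn.
have [k kG] := BU G G0; exists (n, k); have [a0 /kG/= Ga] := Ha (n, k).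
set c := a (n, k) in a0 Ga *.
have [p p0 Gp] := j_approx (vpos_ge0 (j x - b n)) G0.
have q0' : 0 <= w - (j x - b n) by rewrite vl_subr_ge0 le_vpos.
have [q q0 Gq] := j_approx q0' G0.
rewrite -/w in Gp.
have Vp : V p.
  apply/V'V/WV'; rewrite /= -[j p](subrK w); exact: GW.
have Vr : V (x - c - (p - q)).
  apply: V'V; rewrite /= !(linearB j).
  have -> : j x - j c - (j p - j q) =
      (- (j c - b n) - (j p - w)) + (j q - (w - (j x - b n))).
    rewrite !opprB (addrACA (b n)) -[j x - b n - w]addrA -!opprD (addrA (j q)).
    rewrite [X in _ = X + _]addrC [in RHS]addrACA subrr addr0 (addrACA (j x)).
    by rewrite -opprD addrC (addrC (j x)).
  apply: WV; last exact: GW'.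
  by apply: GW; exact: solidN.
apply: U1U; apply: solid_le sU1 (vpos_ge0 _) _
  (VU _ _ Vp (_ : V (vabs (x - c - (p - q))))); last first.
  by apply: sV Vr; rewrite [vabs (vabs _)]ger0_vabs// vabs_ge0.
apply: vpos_le; last by apply: le_trans p0 (vl_leDl _ (vabs_ge0 _)).
rewrite -[leLHS](subrK (p - q)) addrC; apply: vl_leD; last exact: le_vabs.
exact: vl_leBl.
Qed.

End Completion.

(** * The equivalence *)

Theorem theorem4p3 (R : realType) (X : locallySolidType R)
    (X_arch : archimedean X) (X_metrizable : metrizable R X)
    (Xhat : locallySolidType R) (j : {linear X -> Xhat})
    (j_completion : is_completion j) :
  [<-> exists2 A : set X, countable A & closure (ideal_gen A) = setT;
       metrizable R (unbounded X);
       metrizable R (unbounded Xhat);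
       exists e : Xhat, quasi_interior_point e].
Proof.
have baseX := metrizable_base_at (0 : X) X_metrizable.
have baseXhat := completion_base j_completion baseX.
have [_ _ [hXhat cXhat] cone] := j_completion.
tfae.
- move=> [A cA dA]; apply: unbounded_metrizable baseX _.
    exact: metrizable_hausdorff X_metrizable.
  exact: ideal_gen_exhausting dA.
- move=> /metrizable_unbounded_exhausted exX.
  apply: unbounded_metrizable => //.
  exact: (completion_exhausted j_completion) exX.
- move=> /metrizable_unbounded_exhausted.
  apply: complete_exhausted_quasi_interior => //.
  by rewrite cone; exact: closed_closure.
- move=> [e /quasi_interior_exhausted exXhat].
  exact/exhausting_ideal_gen/(exhausted_completion j_completion).
Qed.
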